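(* Let $a,b\in I$ with $a<b$ and $a\le s_0\le b$. Let $f:[a,b]\to\mathbb{R}$ be an absolutely $\beta$-integrable function on $[a,b]$, and suppose that there exist real numbers $m$ and $M$ such that $m\le f(x)\le M$ for all $x\in[a,b]_\beta$. If $u:[a,b]\to\mathbb{R}$ is $L$-Lipschitzian on $[a,b]_\beta$, then $$\left|\int_a^b f(x)\,d_\beta u(x)-\frac{u(b)-u(a)}{b-a}\int_a^b f(t)\,d_\beta t\right|\le\frac12 L(M-m)(b-a).$$ The constant $\frac12$ is the best possible: there is no constant $c<\frac12$ such that the inequality with $\frac12$ replaced by $c$ holds for all admissible data $(I,\beta,a,b,f,u,m,M,L)$.
   Context: Setting: $I\subseteq\mathbb{R}$ is an interval and $\beta:I\to I$ is a strictly increasing continuous function with exactly one fixed point $s_0\in I$, satisfying $(t-s_0)(\beta(t)-t)\le 0$ for all $t\in I$, with equality only if $t=s_0$. Write $\beta^0(t)=t$ and $\beta^k$ for the $k$-fold composition of $\beta$ with itself. For $a,b\in I$, $[a,b]_\beta:=\{\beta^k(a):k\ge 0\}\cup\{\beta^k(b):k\ge 0\}\cup\{s_0\}$. The $\beta$-integral is $\int_a^b h\,d_\beta:=\int_{s_0}^b h\,d_\beta-\int_{s_0}^a h\,d_\beta$, where $\int_{s_0}^x h\,d_\beta:=\sum_{k=0}^{\infty}\big(\beta^k(x)-\beta^{k+1}(x)\big)h\big(\beta^k(x)\big)$; also written $\int_a^b h(x)\,d_\beta x$. The function $h$ is $\beta$-integrable on $[a,b]$ if these series converge for $x=a$ and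 $x=b$, and absolutely $\beta$-integrable on $[a,b]$ if $|h|$ is $\beta$-integrable on $[a,b]$. Riemann–Stieltjes $\beta$-integral: for a real function $u$ of bounded variation on $[a,b]_\beta$, $$\int_a^b f(x)\,d_\beta u(x):=\sum_{k=0}^\infty f(\beta^k(b))\big(u(\beta^k(b))-u(\beta^{k+1}(b))\big)-\sum_{k=0}^\infty f(\beta^k(a))\big(u(\beta^k(a))-u(\beta^{k+1}(a))\big).$$ A real function $u$ is $L$-Lipschitzian on $[a,b]_\beta$ if $|u(x)-u(y)|\le L|x-y|$ for all $x,y\in[a,b]_\beta$. (Such a function is automatically of bounded variation on $[a,b]_\beta$.) *)

(* Defs.v *)
From HB Require Import structures.
From mathcomp Require Import all_boot all_order all_algebra.
From mathcomp Require Import all_classical all_reals all_analysis.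
Import Order.TTheory GRing.Theory Num.Theory numFieldNormedType.Exports.

Set Implicit Arguments.
Unset Strict Implicit.
Unset Printing Implicit Defensive.

Local Open Scope classical_set_scope.
Local Open Scope ring_scope.

Section BetaCalculus.
Variable R : realType.
Implicit Types (I : set R) (beta f h u : R -> R) (a b x s m M L : R).

(* Functions on I or on [a, b] are represented by total functions R -> R;
   the notions below only involve their values on I, resp. on the orbits. *)

Record beta_map I beta s0 : Prop := BetaMap {
  beta_interval : is_interval I;
  beta_stable : forall t, I t -> I (beta t);
  beta_increasing : forall s t, I s -> I t -> s < t -> beta s < beta t;
  beta_continuous : {within I, continuous beta};
  beta_fixed_in : I s0;
  beta_fixed : beta s0 = s0;
  beta_fixed_unique : forall t, I t -> beta t = t -> t = s0;
  beta_sign : forall t, I t -> (t - s0) * (beta t - t) <= 0;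
  beta_sign_eq : forall t, I t -> (t - s0) * (beta t - t) = 0 -> t = s0
}.

(* The set [a, b]_beta. *)
Definition beta_itv beta s0 a b : set R :=
  [set iter k beta a | k in [set: nat]] `|`
  [set iter k beta b | k in [set: nat]] `|` [set s0].

Definition beta_term beta h x : R^nat :=
  fun k => (iter k beta x - iter k.+1 beta x) * h (iter k beta x).

(* The integral from s0 to x. *)
Definition beta_int0 beta h x : R := limn (series (beta_term beta h x)).

Definition beta_int beta h a b : R := beta_int0 beta h b - beta_int0 beta h a.

Definition beta_integrable beta h a b : Prop :=
  cvgn (series (beta_term beta h a)) /\ cvgn (series (beta_term beta h b)).

Definition abs_beta_integrable beta h a b : Prop :=
  beta_integrable beta (fun x => `|h x|) a b.

Definition beta_rs_term beta f u x : R^nat :=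
  fun k => f (iter k beta x) * (u (iter k beta x) - u (iter k.+1 beta x)).

(* The Riemann-Stieltjes integral of f with respect to u; as with [beta_int0],
   it is meaningful when the two series converge. *)
Definition beta_rs_int beta f u a b : R :=
  limn (series (beta_rs_term beta f u b)) -
  limn (series (beta_rs_term beta f u a)).

Record admissible I beta s0 a b f u m M L : Prop := Admissible {
  adm_beta : beta_map I beta s0;
  adm_a : I a;
  adm_b : I b;
  adm_ab : a < b;
  adm_s0 : a <= s0 <= b;
  adm_int : abs_beta_integrable beta f a b;
  adm_bound : forall x, beta_itv beta s0 a b x -> m <= f x <= M;
  adm_lip : L.-lipschitz_(beta_itv beta s0 a b) u
}.

End BetaCalculus.

(* Main.v *)
(* With p := (u b - u a) / (b - a), the function u - p id takes equal values at
   a and b, so f may be replaced by f - (m + M) / 2, which is bounded by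
   (M - m) / 2.  It remains to bound the total variation of u - p id along the
   orbits by L (b - a): increment_deviation makes its majorant telescope to
   (L - p ^ 2 / L) (b - a).  Equality holds for beta t = t / 2 on [-1, 1] with
   f = sg and u = |.|. *)
Require Import Defs.
From HB Require Import structures.
From mathcomp Require Import all_boot all_order all_algebra.
From mathcomp Require Import all_classical all_reals all_analysis.
From mathcomp Require Import ring lra.
Import Order.TTheory GRing.Theory Num.Theory numFieldNormedType.Exports.

Set Implicit Arguments.
Unset Strict Implicit.
Unset Printing Implicit Defensive.

Local Open Scope classical_set_scope.
Local Open Scope ring_scope.

(** * Monotonicity and convergence of the orbits of [beta] *)

Section BetaOrbits.
Variables (R : realType) (I : set R) (beta : R -> R) (s0 : R).
Hypothesis betaP : beta_map I beta s0.

Lemma iter_beta_in x k : I x -> I (iter k beta x).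
Proof. by move=> Ix; elim: k => //= k; exact: (beta_stable betaP). Qed.

(** Monotonicity at the fixed point gives the bound by [s0], the sign condition the bound by [x]. *)
Lemma beta_above x : I x -> s0 <= x -> s0 <= beta x <= x.
Proof.
move=> Ix; rewrite le_eqVlt => /predU1P[<-|s0x].
  by rewrite (beta_fixed betaP) lexx.
rewrite -[in X in X && _](beta_fixed betaP) ltW ?(beta_increasing betaP) //=;
  last exact: beta_fixed_in betaP.
have := beta_sign betaP Ix.
by rewrite pmulr_rle0 ?subr_gt0 // subr_le0.
Qed.

Lemma beta_below x : I x -> x <= s0 -> x <= beta x <= s0.
Proof.
move=> Ix; rewrite le_eqVlt => /predU1P[->|xs0].
  by rewrite (beta_fixed betaP) lexx.
rewrite -[in X in _ && X](beta_fixed betaP).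
rewrite [X in _ && X]ltW ?(beta_increasing betaP) //;
  last exact: beta_fixed_in betaP.
have := beta_sign betaP Ix.
by rewrite andbT nmulr_rle0 ?subr_lt0 // subr_ge0.
Qed.

Lemma iter_beta_above x k : I x -> s0 <= x -> s0 <= iter k beta x <= x.
Proof.
move=> Ix s0x; elim: k => [|k /andP[s0k kx]]; first by rewrite s0x /=.
have /andP[-> /le_trans->//] := beta_above (iter_beta_in k Ix) s0k.
Qed.

Lemma iter_beta_below x k : I x -> x <= s0 -> x <= iter k beta x <= s0.
Proof.
move=> Ix xs0; elim: k => [|k /andP[xk ks0]]; first by rewrite xs0 lexx.
have /andP[kk ->] := beta_below (iter_beta_in k Ix) ks0.
by rewrite (le_trans xk kk).
Qed.

(** The shifted orbit tends both to [l] and, by continuity, to [beta l], so [l] is a fixed point. As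
    [beta] is continuous only within [I], the orbit must first be seen to converge in the trace of
    [nbhs l] on [I]. *)
Lemma iter_beta_lim x l : I x -> I l ->
  iter k beta x @[k --> \oo] --> l -> l = s0.
Proof.
move=> Ix Il xl; apply: (beta_fixed_unique betaP) => //.
have xl' : iter k beta x @[k --> \oo] --> within I (nbhs l).
  move=> A /xl [N _ NA]; exists N => // k /NA; apply.
  exact: iter_beta_in.
have := beta_continuous betaP; rewrite subspace_continuousP => /(_ l Il) bl.
have bxl : iter k.+1 beta x @[k --> \oo] --> beta l.
  by exact: (cvg_comp _ beta xl' bl).
move: xl; rewrite -cvg_shiftS => xl.
exact: (cvg_unique _ bxl xl).
Qed.

(** The orbit is monotone and stays between [x] and [s0]. Its limit does too, hence lies in the
    interval [I], where [s0] is the only possible limit. *)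
Lemma iter_beta_cvg x : I x -> iter k beta x @[k --> \oo] --> s0.
Proof.
move=> Ix; have [s0x|/ltW xs0] := leP s0 x.
- have cx : cvgn (fun k => iter k beta x).
    apply: nonincreasing_is_cvgn.
      apply/nonincreasing_seqP => k.
      have /andP[s0k _] := iter_beta_above k Ix s0x.
      by case/andP: (beta_above (iter_beta_in k Ix) s0k).
    exists s0 => _ [k _ <-].
    by case/andP: (iter_beta_above k Ix s0x).
  suff Il : I (limn (fun k => iter k beta x)).
    by rewrite -(iter_beta_lim Ix Il cx).
  apply: (beta_interval betaP (beta_fixed_in betaP) Ix); apply/andP; split.
  + apply: limr_ge => //; apply: nearW => k.
    by case/andP: (iter_beta_above k Ix s0x).
  + apply: limr_le => //; apply: nearW => k.
    by case/andP: (iter_beta_above k Ix s0x).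
- have cx : cvgn (fun k => iter k beta x).
    apply: nondecreasing_is_cvgn.
      apply/nondecreasing_seqP => k.
      have /andP[_ ks0] := iter_beta_below k Ix xs0.
      by case/andP: (beta_below (iter_beta_in k Ix) ks0).
    exists s0 => _ [k _ <-].
    by case/andP: (iter_beta_below k Ix xs0).
  suff Il : I (limn (fun k => iter k beta x)).
    by rewrite -(iter_beta_lim Ix Il cx).
  apply: (beta_interval betaP Ix (beta_fixed_in betaP)); apply/andP; split.
  + apply: limr_ge => //; apply: nearW => k.
    by case/andP: (iter_beta_below k Ix xs0).
  + apply: limr_le => //; apply: nearW => k.
    by case/andP: (iter_beta_below k Ix xs0).
Qed.

End BetaOrbits.

(** * Series dominated by telescoping series *)

Section Telescoping.
Variable R : realType.
Implicit Types (x v g : R^nat) (e s C K L p : R).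

Lemma series_decrements x n : series (fun k => x k - x k.+1) n = x 0%N - x n.
Proof.
rewrite seriesEnat /=.
under eq_bigr do rewrite -opprB.
by rewrite sumrN telescope_sumr // opprB.
Qed.

Lemma cvg_series_decrements x s : x @ \oo --> s ->
  series (fun k => x k - x k.+1) @ \oo --> x 0%N - s.
Proof.
move=> xs; rewrite (_ : series _ = fun n => x 0%N - x n); last first.
  by apply/funext => n; exact: series_decrements.
by apply: cvgB => //; exact: cvg_cst.
Qed.

(** Comparison test: the dominating terms are the decrements of [K * (e * x k)], whose series
    telescopes. *)
Lemma series_dominated_decrements x s e K (y : R^nat) :
  x @ \oo --> s -> (forall k, 0 <= e * (x k - x k.+1)) ->
  (forall k, `|y k| <= K * (e * (x k - x k.+1))) -> cvgn (series y).
Proof.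
move=> xs ex yx; apply: normed_cvg.
apply: (@series_le_cvg _ _ (fun k => K * (e * (x k - x k.+1)))) => //= [k|].
  exact: le_trans (normr_ge0 _) (yx k).
rewrite (_ : (fun k => _) =
             (fun k => K * (e * x k) - (fun k => K * (e * x k)) k.+1));
  last by apply/funext => k; rewrite !mulrBr.
apply/cvg_ex; eexists; apply: cvg_series_decrements.
by apply: cvgMl_tmp; apply: cvgMl_tmp; exact: xs.
Qed.

(* On [-L, L] the convex function y |-> |y - p| lies below its chord
   y |-> L - p y / L; here y is the slope dv / dx.  If L = 0 then p = dv = 0. *)
Lemma increment_deviation L p dx dv : `|p| <= L -> `|dv| <= L * dx ->
  `|dv - p * dx| <= L * dx - p / L * dv.
Proof.
rewrite !ler_norml => /andP[p1 p2] /andP[v1 v2].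
have [L0|L0] := eqVneq L 0.
  move: p1 p2 v1 v2; rewrite L0 oppr0 mul0r => p1 p2 v1 v2.
  have -> : p = 0 by apply/eqP; rewrite eq_le p1 p2.
  have -> : dv = 0 by apply/eqP; rewrite eq_le v2 -oppr0 v1.
  by rewrite !mul0r subr0 oppr0 lexx.
have {L0} Lp : 0 < L by lra.
have -> : p / L * dv = p * dv / L by rewrite mulrAC.
have -> : L * dx - p * dv / L = (L * (L * dx) - p * dv) / L.
  by field; rewrite gt_eqF.
(* Once [L] is cleared, the two gaps factor as [(L - p) * (L * dx + dv)] and
   [(L + p) * (L * dx - dv)]. *)
rewrite lerNl ler_pdivlMr // ler_pdivlMr //; apply/andP; split.
- have : 0 <= (L - p) * (L * dx + dv) by apply: mulr_ge0; lra.
  by lra.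
- have : 0 <= (L + p) * (L * dx - dv) by apply: mulr_ge0; lra.
  by lra.
Qed.

(** Here [x] is an orbit, and [v] and [g] are the values of [u] and [f] on it. Centring [g] at [C]
    costs exactly the telescoped term in [C]. The sign [e] makes the decrements of [x] nonnegative,
    so that the majorant telescopes too. *)
Lemma stieltjes_deviation x v g s t e C K L p :
  x @ \oo --> s -> v @ \oo --> t -> `|e| = 1 ->
  (forall k, 0 <= e * (x k - x k.+1)) ->
  (forall k, `|v k - v k.+1| <= L * `|x k - x k.+1|) ->
  (forall k, `|g k - C| <= K) -> `|p| <= L ->
  `|limn (series (fun k => g k * (v k - v k.+1)))
    - p * limn (series (fun k => (x k - x k.+1) * g k))
    - C * ((v 0%N - t) - p * (x 0%N - s))|
  <= K * (L * (e * (x 0%N - s)) - p / L * (e * (v 0%N - t))).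
Proof.
move=> xs vt e1 ex vx gC pL.
have absx k : `|x k - x k.+1| = e * (x k - x k.+1).
  by rewrite -[RHS]ger0_norm // normrM e1 mul1r.
have gK k : `|g k| <= K + `|C|.
  by rewrite -(subrK C (g k)) (le_trans (ler_normD _ _)) // lerD2r.
have L0 : 0 <= L by exact: le_trans pL.
have cv : cvgn (series (fun k => g k * (v k - v k.+1))).
  apply: (@series_dominated_decrements x s e ((K + `|C|) * L)) => // k.
  by rewrite normrM -mulrA -absx ler_pM.
have cx : cvgn (series (fun k => (x k - x k.+1) * g k)).
  apply: (@series_dominated_decrements x s e (K + `|C|)) => // k.
  by rewrite normrM mulrC -absx ler_wpM2r.
pose A := series (fun k => g k * (v k - v k.+1)).
pose B := series (fun k => (x k - x k.+1) * g k).
pose V := series (fun k => v k - v k.+1).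
pose X := series (fun k => x k - x k.+1).
have cX : X n @[n --> \oo] --> x 0%N - s by exact: cvg_series_decrements.
have cV : V n @[n --> \oo] --> v 0%N - t by exact: cvg_series_decrements.
(* The inequality is proved for partial sums, term by term, and then passed to the limit. *)
apply: (@ler_cvg_to _ \oo _ R
  (fun n => `|A n - p * B n - C * (V n - p * X n)|)
  (fun n => K * (L * (e * X n) - p / L * (e * V n)))).
- apply: cvg_norm; apply: cvgB.
    by apply: cvgB; [exact: cv|exact: cvgMl_tmp].
  by apply: cvgMl_tmp; apply: cvgB => //; exact: cvgMl_tmp.
- apply: cvgMl_tmp; apply: cvgB; by do 2 apply: cvgMl_tmp.
apply: nearW => n; rewrite /A /B /V /X.
rewrite !seriesEnat /=.
rewrite !(mulr_sumr, =^~ sumrB).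
apply: (le_trans (ler_norm_sum _ _ _)); apply: ler_sum => k _.
rewrite (_ : _ - _ = (g k - C) * ((v k - v k.+1) - p * (x k - x k.+1)));
  last by ring.
rewrite normrM; apply: ler_pM => //.
(* Multiplying inside the norm by [e] replaces both increments by their signed versions, to which
   [increment_deviation] applies. *)
rewrite -[leLHS]mul1r -e1 -normrM mulrBr mulrCA.
by apply: increment_deviation; rewrite // normrM e1 mul1r -absx.
Qed.

End Telescoping.

(** * The inequality with constant 1/2 *)

Section UpperBound.
Variables (R : realType) (I : set R) (beta : R -> R) (s0 a b : R).
Variables (f u : R -> R) (m M L : R).
Hypothesis adm : admissible I beta s0 a b f u m M L.

Let betaP : beta_map I beta s0 := adm_beta adm.
Let p := (u b - u a) / (b - a).
Let orb := beta_itv beta s0 a b.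

Lemma orbit_lipschitz x y : orb x -> orb y -> `|u x - u y| <= L * `|x - y|.
Proof.
move=> ox oy.
exact: (adm_lip adm (conj ox oy : (orb `*` orb) (x, y))).
Qed.

Lemma stieltjes_deviation_endpoint e x : `|e| = 1 -> I x ->
  (forall k, orb (iter k beta x)) ->
  (forall k, 0 <= e * (iter k beta x - iter k.+1 beta x)) ->
  `|limn (series (beta_rs_term beta f u x)) - p * beta_int0 beta f x
    - (m + M) / 2 * ((u x - u s0) - p * (x - s0))|
  <= (M - m) / 2 * (L * (e * (x - s0)) - p / L * (e * (u x - u s0))).
Proof.
move=> e1 Ix ox ex.
have xs := iter_beta_cvg betaP Ix.
have os0 : orb s0 by right.
have oa : orb a by left; left; exists 0%N.
have ob : orb b by left; right; exists 0%N.
apply: (@stieltjes_deviation R (fun k => iter k beta x)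
  (fun k => u (iter k beta x)) (fun k => f (iter k beta x))) => //.
(* The Lipschitz bound makes [u] tend to [u s0] along the orbit. *)
- have Lx0 : L * `|s0 - iter k beta x| @[k --> \oo] --> 0.
    rewrite -(mulr0 L) -(normr0 R) -(subrr s0).
    apply: cvgMl_tmp; apply: cvg_norm; apply: cvgB => //; exact: cvg_cst.
  apply/cvgrPdist_le => /= eps eps0.
  move/cvgrPdist_le: Lx0 => /(_ _ eps0); apply: filterS => k.
  rewrite sub0r normrN => /(le_trans (ler_norm _)); apply: le_trans.
  exact: orbit_lipschitz.
- by move=> k; exact: orbit_lipschitz (ox k) (ox k.+1).
- by move=> k; have := adm_bound adm (ox k); rewrite ler_norml; lra.
(* [p] is the slope of a chord between two points of the orbit set, so [|p| <= L]. *)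
- rewrite /p normrM normfV ler_pdivrMr; last first.
    by rewrite normr_gt0 subr_eq0 gt_eqF ?(adm_ab adm).
  exact: orbit_lipschitz.
Qed.

Lemma beta_rs_int_deviation :
  `|beta_rs_int beta f u a b - p * beta_int beta f a b|
  <= 1 / 2 * L * (M - m) * (b - a).
Proof.
have /andP[as0 s0b] := adm_s0 adm.
have Ia := adm_a adm; have Ib := adm_b adm; have ab := adm_ab adm.
have hb : forall k, 0 <= 1 * (iter k beta b - iter k.+1 beta b).
  move=> k; rewrite mul1r subr_ge0.
  have /andP[s0k _] := iter_beta_above betaP k Ib s0b.
  by case/andP: (beta_above betaP (iter_beta_in betaP k Ib) s0k).
(* The orbit of [a] increases to [s0], whence the sign [-1]. *)
have ha : forall k, 0 <= -1 * (iter k beta a - iter k.+1 beta a).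
  move=> k; rewrite mulN1r opprB subr_ge0.
  have /andP[_ ks0] := iter_beta_below betaP k Ia as0.
  by case/andP: (beta_below betaP (iter_beta_in betaP k Ia) ks0).
have ob k : orb (iter k beta b) by left; right; exists k.
have oa k : orb (iter k beta a) by left; left; exists k.
have := stieltjes_deviation_endpoint (normr1 _) Ib ob hb.
have := stieltjes_deviation_endpoint (normrN1 _) Ia oa ha.
rewrite /beta_rs_int /beta_int.
set Aa := limn _; set Ab := limn _; set Ba := beta_int0 _ _ a.
set Bb := beta_int0 _ _ b => da db.
have pab : u b - u a = p * (b - a).
  by rewrite /p divfK // subr_eq0 gt_eqF.
have M0 : 0 <= (M - m) / 2.
  have /andP[mf fM] := adm_bound adm (oa 0%N).
  by rewrite divr_ge0 // subr_ge0 (le_trans mf).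
have L0 : 0 <= L.
  have := le_trans (normr_ge0 _) (orbit_lipschitz (ob 0%N) (oa 0%N)).
  by rewrite pmulr_lge0 // normr_gt0 subr_eq0 gt_eqF.
(* This is what the two majorants subtract from [L * (b - a)] when added, up to the factor
   [(M - m) / 2]. For [L = 0] it is 0, since division by 0 gives 0. *)
have pp : 0 <= p / L * (u b - u a).
  rewrite pab (_ : _ * _ = p ^+ 2 * (b - a) / L); last by ring.
  by apply: divr_ge0 => //; apply: mulr_ge0; rewrite ?sqr_ge0 // subr_ge0 ltW.
have Mpp := mulr_ge0 M0 pp.
(* In the difference of the centring terms [s0] drops out, and what is left vanishes by [pab]. *)
rewrite (_ : _ - _ = (Ab - p * Bb - (m + M) / 2 * (u b - u s0 - p * (b - s0)))
  - (Aa - p * Ba - (m + M) / 2 * (u a - u s0 - p * (a - s0)))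
  + (m + M) / 2 * ((u b - u a) - p * (b - a))); last by ring.
rewrite pab subrr mulr0 addr0.
apply: le_trans (ler_normB _ _) _.
apply: le_trans (lerD db da) _.
by lra.
Qed.

End UpperBound.

(** * An extremal example *)

Section Sharpness.
Variable R : realType.

Let half (t : R) : R := t / 2.

Lemma beta_map_half : beta_map setT half 0.
Proof.
split=> //.
- by move=> s t _ _ st; rewrite /half; lra.
- by apply: continuous_subspaceT => t; apply: cvgMr_tmp; exact: cvg_id.
- by rewrite /half mul0r.
- by move=> t _; rewrite /half; lra.
- move=> t _; rewrite /half subr0 (_ : t * _ = - (t ^+ 2 / 2)); last by field.
  by rewrite oppr_le0 mulr_ge0 ?sqr_ge0.
- move=> t _; rewrite /half subr0 (_ : t * _ = - (t ^+ 2 / 2)); last by field.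
  move/eqP; rewrite oppr_eq0 mulf_eq0 invr_eq0 (pnatr_eq0 _ 2) orbF sqrf_eq0.
  by move/eqP.
Qed.

Lemma cvg_series_half (x : R) :
  series (fun k => iter k half x - iter k.+1 half x) @ \oo --> x.
Proof.
rewrite -[X in _ --> X]subr0.
apply: (@cvg_series_decrements _ (fun k => iter k half x)).
exact: (iter_beta_cvg beta_map_half).
Qed.

Lemma sg_half (y : R) : Num.sg (half y) = Num.sg y.
Proof. by rewrite /half sgrM (gtr0_sg (x := 2^-1)) ?mulr1 // invr_gt0. Qed.

Lemma sg_iter_half k (x : R) : Num.sg (iter k half x) = Num.sg x.
Proof. by elim: k => //= k <-; exact: sg_half. Qed.

(** Halving preserves the sign, so [y = sg y * |y|] turns each term into a decrement of the orbit,
    and the series telescopes to [x]. *)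
Lemma rs_term_sg_norm (x : R) :
  beta_rs_term half Num.sg Num.norm x =
  fun k => iter k half x - iter k.+1 half x.
Proof.
apply/funext => k; rewrite /beta_rs_term mulrBr -{2}(sg_half (iter k half x)).
by rewrite -!numEsg.
Qed.

Lemma abs_beta_integrable_sg_half (x : R) : x != 0 ->
  cvgn (series (beta_term half (fun y => `|Num.sg y|) x)).
Proof.
move=> x0; apply/cvg_ex; exists x.
rewrite (_ : beta_term _ _ _ = fun k => iter k half x - iter k.+1 half x).
  exact: cvg_series_half.
apply/funext => k.
by rewrite /beta_term /= sg_iter_half normr_sg x0 mulr1.
Qed.

Lemma admissible_sg_norm :
  admissible setT half 0 (-1) 1 Num.sg Num.norm (-1) 1 (1 : R).
Proof.
split=> //.
- exact: beta_map_half.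
- by lra.
- by split; apply: abs_beta_integrable_sg_half; rewrite ?oppr_eq0 oner_eq0.
- by move=> x _; rewrite -ler_norml normr_sg lern1 leq_b1.
- by move=> [x y] _ /=; rewrite mul1r ler_dist_dist.
Qed.

Lemma beta_rs_int_sg_norm : beta_rs_int half Num.sg Num.norm (-1) 1 = 2 :> R.
Proof.
have lim_half x : limn (series (fun k => iter k half x - iter k.+1 half x)) = x.
  by apply: cvg_lim => //; exact: cvg_series_half.
by rewrite /beta_rs_int !rs_term_sg_norm !lim_half; lra.
Qed.

End Sharpness.

Theorem corollary4p10 (R : realType) :
  (forall (I : set R) (beta : R -> R) (s0 a b : R) (f u : R -> R) (m M L : R),
     admissible I beta s0 a b f u m M L ->
     `|beta_rs_int beta f u a b
       - (u b - u a) / (b - a) * beta_int beta f a b|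
     <= 1 / 2 * L * (M - m) * (b - a))
  /\
  ~ (exists c : R, c < 1 / 2 /\
      forall (I : set R) (beta : R -> R) (s0 a b : R) (f u : R -> R)
             (m M L : R),
        admissible I beta s0 a b f u m M L ->
        `|beta_rs_int beta f u a b
          - (u b - u a) / (b - a) * beta_int beta f a b|
        <= c * L * (M - m) * (b - a)).
Proof.
split; first by move=> I beta s0 a b f u m M L; exact: beta_rs_int_deviation.
move=> [c [c2 /(_ _ _ _ _ _ _ _ _ _ _ (admissible_sg_norm R))]].
(* The chord slope of the norm over [[-1, 1]] is 0, so the inequality reads [2 <= c * 1 * 2 * 2]. *)
rewrite beta_rs_int_sg_norm normrN1 normr1 subrr !mul0r subr0 ger0_norm //.
by lra.
Qed.
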